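(* Let $(X,f_{1,\infty})$ be a nonautonomous dynamical system, and let $\mathcal{U},\mathcal{U}_i,\mathcal{V}$ be finite open covers of $X$. Then for any $\alpha\in\mathbb{R}$, $s>0$ and nonempty subsets $K,K_i\subseteq X$: (1) If $\mathcal{U}\preceq\mathcal{V}$, then $m(f_{1,\infty},K,s,\mathcal{U},\alpha)\le m(f_{1,\infty},K,s,\mathcal{V},\alpha)$ and $D(f_{1,\infty},K,s,\mathcal{U})\le D(f_{1,\infty},K,s,\mathcal{V})$. (2) For covers $\mathcal{U}_1,\dots,\mathcal{U}_m$, $\max_{1\le i\le m}D(f_{1,\infty},K,s,\mathcal{U}_i)\le D(f_{1,\infty},K,s,\bigvee_{i=1}^m\mathcal{U}_i)$. (3) If $K\subseteq Z\subseteq X$, then $D(f_{1,\infty},K,s)\le D(f_{1,\infty},Z,s)$ and $D(f_{1,\infty},K)\le D(f_{1,\infty},Z)$. (4) For a countable family $(K_i)_{i\ge1}$, $$m\Big(f_{1,\infty},\bigcup_{i\ge1}K_i,s,\mathcal{U},\alpha\Big)\le\sum_{i\ge1}m(f_{1,\infty},K_i,s,\mathcal{U},\alpha),$$ $$D\Big(f_{1,\infty},\bigcup_{i\ge1}K_i,s\Big)=\sup_{i\ge1}D(f_{1,\infty},K_i,s),\qquad D\Big(f_{1,\infty},\bigcup_{i\ge1}K_i\Big)=\sup_{i\ge1}D(f_{1,\infty},K_i).$$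
   Context: A nonautonomous dynamical system $(X,f_{1,\infty})$ consists of a compact topological space $X$ and a sequence $f_{1,\infty}=(f_i)_{i\ge 1}$ of continuous maps $f_i:X\to X$. Put $f_1^0=\mathrm{id}_X$, $f_1^j=f_j\circ\cdots\circ f_1$. For covers, $\mathcal{U}\preceq\mathcal{V}$ means that $\mathcal{V}$ is a refinement of $\mathcal{U}$: every member of $\mathcal{V}$ is contained in a member of $\mathcal{U}$. The join is $\bigvee_{i=1}^m\mathcal{U}_i=\{U_1\cap\cdots\cap U_m:U_i\in\mathcal{U}_i\}$. For a finite open cover $\mathcal{U}$ of $X$, let $S(\mathcal{U})$ be the set of all finite strings $\mathbf{U}=(U_{i_0},\dots,U_{i_{m-1}})$ of elements of $\mathcal{U}$, with length $m(\mathbf{U})=m$, and let $X(\mathbf{U})=\{x\in X: f_1^j(x)\in U_{i_j},\ 0\le j\le m(\mathbf{U})-1\}$. A collection $\mathcal{G}\subseteq S(\mathcal{U})$ covers $K$ if $K\subseteq\bigcup_{\mathbf{U}\in\mathcal{G}}X(\mathbf{U})$. For nonempty $K\subseteq X$, $\alpha\in\mathbb{R}$, $s>0$ let $M(f_{1,\infty},K,s,\mathcal{U},\alpha,N)=\inf_{\mathcal{G}}\sum_{\mathbf{U}\in\mathcal{G}}e^{-\alpha m(\mathbf{U})^s}$, the infimum over all finite or countable $\mathcal{G}\subseteq S(\mathcal{U})$ covering $K$ with $m(\mathbf{U})\ge N$ for all $\mathbf{U}\in\mathcal{G}$. Let $m(f_{1,\infty},K,s,\mathcal{U},\alpha)=\lim_{N\to\infty}M(f_{1,\infty},K,s,\mathcal{U},\alpha,N)\in[0,\infty]$,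 $D(f_{1,\infty},K,s,\mathcal{U})=\inf\{\alpha: m(f_{1,\infty},K,s,\mathcal{U},\alpha)=0\}=\sup\{\alpha: m(f_{1,\infty},K,s,\mathcal{U},\alpha)=\infty\}$, and $D(f_{1,\infty},K,s)=\sup_{\mathcal{U}}D(f_{1,\infty},K,s,\mathcal{U})$ over finite open covers $\mathcal{U}$ of $X$. Then $D(f_{1,\infty},K)=\sup\{s>0:D(f_{1,\infty},K,s)=+\infty\}=\inf\{s>0:D(f_{1,\infty},K,s)=0\}$, with $\inf\emptyset=+\infty$ and $\sup\emptyset=0$ for sets of $s>0$. *)

(* Defs.v *)
From HB Require Import structures.
From mathcomp Require Import all_boot all_order all_algebra.
From mathcomp Require Import all_classical all_reals all_analysis.
Set Implicit Arguments.
Unset Strict Implicit.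
Unset Printing Implicit Defensive.
Import Order.TTheory GRing.Theory Num.Theory.
Import numFieldNormedType.Exports.
Local Open Scope classical_set_scope.
Local Open Scope ring_scope.

(* Sequences are indexed from 0: the Rocq term [f i] stands for f_{i+1}, so
   that [orbit_map f j] is f_1^j = f_j \o ... \o f_1. *)
Fixpoint orbit_map (X : Type) (f : nat -> X -> X) (j : nat) (x : X) : X :=
  if j is j'.+1 then f j' (orbit_map f j' x) else x.

Definition finite_open_cover (X : topologicalType) (U : set (set X)) : Prop :=
  [/\ finite_set U, (forall A, U A -> open A) & \bigcup_(A in U) A = [set: X]].

(* U precedes V: V is a refinement of U *)
Definition refined_by (X : Type) (U V : set (set X)) : Prop :=
  forall B, V B -> exists2 A, U A & B `<=` A.

Definition join_covers (X : Type) (n : nat) (U : 'I_n -> set (set X)) :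
    set (set X) :=
  [set \bigcap_(i in [set: 'I_n]) W i | W in [set W | forall i, U i (W i)]].

Definition strings (X : Type) (U : set (set X)) : set (seq (set X)) :=
  [set u | (0 < size u)%N /\ forall j, (j < size u)%N -> U (nth set0 u j)].

Definition string_set (X : Type) (f : nat -> X -> X) (u : seq (set X)) :
    set X :=
  [set x | forall j, (j < size u)%N -> nth set0 u j (orbit_map f j x)].

Definition admissible (X : Type) (f : nat -> X -> X) (K : set X)
    (U : set (set X)) (N : nat) (G : set (seq (set X))) : Prop :=
  [/\ G `<=` strings U, countable G,
      K `<=` \bigcup_(u in G) string_set f u
    & forall u, G u -> (N <= size u)%N].

Section entropy.
Variables (R : realType) (X : topologicalType) (f : nat -> X -> X).
Local Open Scope ereal_scope.

Definition outer_M (K : set X) (s : R) (U : set (set X)) (alpha : R)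
    (N : nat) : \bar R :=
  ereal_inf [set \esum_(u in G) (expR (- alpha * (size u)%:R `^ s)%R)%:E
            | G in admissible f K U N].

(* The sequence is nondecreasing in N, hence convergent in \bar R. *)
Definition outer_m (K : set X) (s : R) (U : set (set X)) (alpha : R) : \bar R :=
  limn (outer_M K s U alpha).

Definition D_cover (K : set X) (s : R) (U : set (set X)) : \bar R :=
  ereal_inf [set alpha%:E | alpha in [set alpha : R | outer_m K s U alpha = 0]].

Definition D_order (K : set X) (s : R) : \bar R :=
  ereal_sup [set D_cover K s U | U in @finite_open_cover X].

(* [maxe 0] implements the convention that the supremum of the empty set of
   positive orders is 0 ([ereal_sup set0] is -oo). *)
Definition D_dim (K : set X) : \bar R :=
  maxe 0 (ereal_sup
    [set s%:E | s in [set s : R | (0 < s)%R /\ D_order K s = +oo]]).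

End entropy.
Arguments D_dim R {X} f K.

(* Main.v *)
Require Import Defs.
From HB Require Import structures.
From mathcomp Require Import all_boot all_order all_algebra.
From mathcomp Require Import all_classical all_reals all_analysis.
Set Implicit Arguments.
Unset Strict Implicit.
Unset Printing Implicit Defensive.
Import Order.TTheory GRing.Theory Num.Theory.
Import numFieldNormedType.Exports.
Local Open Scope classical_set_scope.
Local Open Scope ring_scope.
Local Open Scope ereal_scope.

(** The quantities [outer_M], [outer_m], [D_cover], [D_order] and [D_dim] are
    built like Hausdorff measure and dimension, with strings of length [m]
    weighted by [exp (- alpha m ^ s)], and the proof follows that model.

    Monotonicity (in the set, and under refinement of the cover) comes from
    moving collections of strings: replacing each member of a finer cover by a
    member of the coarser one that contains it keeps the lengths and enlarges
    the sets of points described by the strings ([le_outer_M], [le_outer_m]).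
    A join refines each of its factors, which gives the bound on joins.

    Countable subadditivity of [outer_m] is the usual e / 2 ^ i argument
    ([outer_M_bigcup]).  It passes to suprema of [D_cover] because [outer_m]
    vanishes at every parameter strictly above [D_cover] ([outer_m_eq0]), and a
    countable sum of zeros is zero; taking suprema over covers gives [D_order].

    For [D_dim], the point is the jump at the critical order ([D_order_eqy]): a
    positive [D_order] at order [s] forces the value [+oo] at all orders below
    [s], as [n ^ s] dominates every multiple of [n ^ t] for [t < s].  If
    [D_order] of the union is [+oo] at order [s], then some [K i] has positive
    [D_order] at order [s], hence [D_dim] at least [s]. *)


(** * Extended sums and extended reals *)

(** A section of [e] over [Q] embeds the terms of the left sum among those of
    the right one, whatever the collisions of [e] and the signs of [a].  With
    [e] a map on strings this transports collections between covers; with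
    [e = snd] it bounds a sum over a non-disjoint union by the iterated sum. *)
Lemma esum_le_image (R : realType) (T T' : choiceType) (P : set T)
    (Q : set T') (e : T -> T') (a : T' -> \bar R) :
  Q `<=` e @` P ->
  \esum_(j in Q) a j <= \esum_(i in P) a (e i).
Proof.
move=> QeP; have [i0|noT] := pselect (exists i : T, True); last first.
  suff -> : Q = set0 by rewrite esum_set0 esum_ge//; exists set0 => //;
    [exact: fsets_set0|rewrite fsbig_set0].
  by rewrite -subset0 => j /QeP[i _ _]; apply: noT; exists i.
have [g gP] : exists g : T' -> T, forall j, Q j -> P (g j) /\ e (g j) = j.
  case: i0 => i0 _.
  have /choice[g gP] : forall j, exists i, Q j -> P i /\ e i = j.
    move=> j; have [/QeP[i Pi eij]|nQj] := pselect (Q j); first by exists i.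
    by exists i0.
  by exists g.
have g_inj : set_inj Q g.
  by move=> x y /[!inE] /gP[_ {2}<-] /gP[_ {2}<-] ->.
rewrite (eq_esum (b := fun j => a (e (g j)))); last by move=> j /gP[_ ->].
rewrite -(esum_image Q g (a \o e)) //.
apply: ereal_sup_le => _ [A [finA AQ] <-]; exists A => //; split => //.
by move=> _ /AQ [j /gP[Pgj _] <-].
Qed.

(** Unlike [lee_addgt0Pr], this criterion remains usable when [y = -oo]. *)
Lemma le_ereal_real_gt (R : realType) (x y : \bar R) :
  (forall r : R, y < r%:E -> x <= r%:E) -> x <= y.
Proof.
case: y => [y||] xle; last 2 first.
- exact: leey.
- by rewrite (eq_ninfty (x := x))// => r; exact/xle/ltNyr.
apply/lee_addgt0Pr => e e0; rewrite -EFinD; apply: xle.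
by rewrite lte_fin ltrDl.
Qed.

(** * Monotonicity in the set, the cover, the order and the parameter *)

Section entropy_properties.
Variables (R : realType) (X : topologicalType) (f : nat -> X -> X).
Implicit Types (K Z : set X) (U V : set (set X)) (s alpha : R) (N : nat).

(** Every monotonicity property used below is an instance of this comparison:
    a collection of strings over [V] covering [Z] becomes, on replacing each
    member of [V] by a member of [U] that contains it, a collection over [U]
    with the same lengths that covers [K], and whose terms are smaller as soon
    as the exponents are. *)
Lemma le_outer_M K Z s1 s2 U V a1 a2 N :
  K `<=` Z -> refined_by U V ->
  (forall n, (N <= n)%N ->
     (- a1 * n%:R `^ s1 <= - a2 * n%:R `^ s2)%R) ->
  outer_M f K s1 U a1 N <= outer_M f Z s2 V a2 N.
Proof.
move=> KZ UV le_weight.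
have /choice[phi phiP] : forall B, exists A, V B -> U A /\ B `<=` A.
  move=> B; have [/UV[A UA BA]|nVB] := pselect (V B); first by exists A.
  by exists set0.
apply: le_ereal_inf_tmp => _ [G [GV cG ZG GN] <-].
apply: ge_ereal_inf; exists (\esum_(u in map phi @` G)
    (expR (- a1 * (size u)%:R `^ s1))%:E).
  exists (map phi @` G) => //; split.
  - move=> _ [u /GV[u_gt0 uV] <-]; split; rewrite size_map// => j ju.
    by rewrite (nth_map set0)//; apply: (phiP _ _).1; exact: uV.
  - exact: card_le_trans (card_image_le _ _) cG.
  - move=> x /KZ/ZG[u Gu ux]; exists (map phi u); first by exists u.
    move=> j; rewrite size_map => ju; rewrite (nth_map set0)//.
    by apply: (phiP _ _).2 (ux _ ju); exact: (GV _ Gu).2.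
  - by move=> _ [u /GN Nu <-]; rewrite size_map.
(* Distinct strings over V may have the same image: only <= holds here. *)
apply: (@le_trans _ _ (\esum_(u in G)
    (expR (- a1 * (size (map phi u))%:R `^ s1))%:E)).
  exact: esum_le_image.
apply: le_esum => u /GN Nu.
by rewrite size_map lee_fin ler_expR le_weight.
Qed.

Lemma outer_M_nondecreasing K s U alpha :
  nondecreasing_seq (outer_M f K s U alpha).
Proof.
move=> N N' NN'; apply: ereal_inf_le_tmp => _ [G [GU cG KG GN] <-].
by exists G => //; split=> // u /GN; exact: leq_trans.
Qed.

Lemma outer_mE K s U alpha :
  outer_m f K s U alpha = ereal_sup (range (outer_M f K s U alpha)).
Proof.
by apply/cvg_lim => //; apply/ereal_nondecreasing_cvgn/outer_M_nondecreasing.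
Qed.

Lemma outer_M_le_m K s U alpha N :
  outer_M f K s U alpha N <= outer_m f K s U alpha.
Proof. by rewrite outer_mE; apply: ereal_sup_ubound; exists N. Qed.

Lemma outer_M_ge0 K s U alpha N : 0 <= outer_M f K s U alpha N.
Proof.
apply: le_ereal_inf_tmp => _ [G _ <-].
by apply: esum_ge0 => u _; rewrite lee_fin expR_ge0.
Qed.

Lemma outer_m_ge0 K s U alpha : 0 <= outer_m f K s U alpha.
Proof. exact: le_trans (outer_M_ge0 _ _ _ _ 0) (outer_M_le_m _ _ _ _ _). Qed.

(** In the limit only long strings count, so the exponents need only be
    compared for large lengths; this allows a change of the order [s]. *)
Lemma le_outer_m K Z s1 s2 U V a1 a2 :
  K `<=` Z -> refined_by U V ->
  (\forall n \near \oo, (- a1 * n%:R `^ s1 <= - a2 * n%:R `^ s2)%R) ->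
  outer_m f K s1 U a1 <= outer_m f Z s2 V a2.
Proof.
move=> KZ UV [N0 _ le_weight].
rewrite outer_mE; apply: ge_ereal_sup => _ [N _ <-].
apply: (le_trans (outer_M_nondecreasing K s1 U a1 (leq_maxl N N0))).
apply: le_trans (outer_M_le_m _ _ _ _ (maxn N N0)).
apply: le_outer_M => // n; rewrite geq_max => /andP[_ N0n].
exact: le_weight.
Qed.

Lemma refined_by_refl U : refined_by U U.
Proof. by move=> A UA; exists A. Qed.

Lemma le_D_cover K Z s U V :
  K `<=` Z -> refined_by U V -> D_cover f K s U <= D_cover f Z s V.
Proof.
move=> KZ UV; apply: ereal_inf_le_tmp => _ [a /= ma0 <-]; exists a => //=.
apply/eqP; rewrite eq_le outer_m_ge0 -ma0 andbT.
by apply: le_outer_m => //; exact: nearW.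
Qed.

Lemma le_D_order K Z s : K `<=` Z -> D_order f K s <= D_order f Z s.
Proof.
move=> KZ; apply: ge_ereal_sup => _ [U Ucov <-].
apply: le_ereal_sup_tmp; exists (D_cover f Z s U); first by exists U.
exact/le_D_cover/refined_by_refl.
Qed.

Lemma le_D_dim K Z : K `<=` Z -> D_dim R f K <= D_dim R f Z.
Proof.
move=> KZ; rewrite /D_dim ge_max le_max lexx/=.
rewrite le_max; apply/orP; right.
apply: ereal_sup_le => _ [s [s0 Ks] <-]; exists s; last by [].
split; first exact: s0.
by apply/eqP; rewrite -leye_eq -Ks le_D_order.
Qed.

(** * Countable unions *)

(** The argument that makes an outer measure countably subadditive: choose for
    each [i] a collection covering [K i] which is optimal up to [e / 2 ^ i.+1],
    and take the union of these collections. *)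
Lemma outer_M_bigcup (K : nat -> set X) s U alpha N :
  outer_M f (\bigcup_i K i) s U alpha N
    <= \sum_(0 <= i <oo) outer_M f (K i) s U alpha N.
Proof.
have [[i KiNy]|fin] := pselect (exists i, outer_M f (K i) s U alpha N = +oo).
  rewrite (@nneseries_pinfty _ _ _ i) ?leey// => n _; exact: outer_M_ge0.
apply/lee_addgt0Pr => e e0.
have approx i : exists G, admissible f (K i) U N G /\
    \esum_(u in G) (expR (- alpha * (size u)%:R `^ s))%:E
      <= outer_M f (K i) s U alpha N + (e / (2 ^ i.+1)%:R)%:E.
  have Mfin : outer_M f (K i) s U alpha N \is a fin_num.
    rewrite ge0_fin_numE ?outer_M_ge0// ltey.
    by apply/negP => /eqP KiNy; apply: fin; exists i.
  have ei0 : (0 < e / (2 ^ i.+1)%:R)%R by rewrite divr_gt0// ltr0n expn_gt0.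
  have [_ [G Gadm <-] /ltW Gle] := lb_ereal_inf_adherent ei0 Mfin.
  by exists G.
have /choice[G GP] := approx.
have w0 (u : seq (set X)) : 0 <= (expR (- alpha * (size u)%:R `^ s))%:E.
  by rewrite lee_fin expR_ge0.
apply: (@le_trans _ _ (\esum_(u in \bigcup_i G i)
    (expR (- alpha * (size u)%:R `^ s))%:E)).
  apply: ereal_inf_lbound; exists (\bigcup_i G i) => //; split.
  - by move=> u [i _ Giu]; have [[GU _ _ _] _] := GP i; exact: GU.
  - by apply: bigcup_countable => // i _; have [[]] := GP i.
  - move=> x [i _ Kix]; have [[_ _ KG _] _] := GP i.
    by have [u Giu ux] := KG _ Kix; exists u => //; exists i.
  - by move=> u [i _ Giu]; have [[_ _ _ GN] _] := GP i; exact: GN.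
apply: le_trans (epsilon_trick xpredT _ (ltW e0)); last first.
  by move=> i; exact: outer_M_ge0.
apply: (@le_trans _ _ (\sum_(0 <= i <oo) \esum_(u in G i)
    (expR (- alpha * (size u)%:R `^ s))%:E)); last first.
  apply: lee_nneseries => i _; last by have [] := GP i.
  by move=> _; apply: esum_ge0.
rewrite nneseries_esumT; last by move=> i; apply: esum_ge0.
rewrite esum_esum//.
apply: (esum_le_image (e := snd)) => u [i _ Giu].
by exists (i, u).
Qed.

Lemma outer_m_bigcup (K : nat -> set X) s U alpha :
  outer_m f (\bigcup_i K i) s U alpha
    <= \sum_(0 <= i <oo) outer_m f (K i) s U alpha.
Proof.
rewrite outer_mE; apply: ge_ereal_sup => _ [N _ <-].
apply: le_trans (outer_M_bigcup _ _ _ _ _) _.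
by apply: lee_nneseries => i _; [move=> _; exact: outer_M_ge0|
  exact: outer_M_le_m].
Qed.

(** The parameters at which [outer_m] vanishes form an up-set, since the terms
    [exp (- alpha m ^ s)] decrease in [alpha]. *)
Lemma outer_m_eq0 K s U alpha :
  D_cover f K s U < alpha%:E -> outer_m f K s U alpha = 0.
Proof.
move=> /ereal_inf_lt[_ [a /= ma0 <-]]; rewrite lte_fin => a_lt.
apply/eqP; rewrite eq_le outer_m_ge0 -ma0 andbT.
apply: le_outer_m => //; first exact: refined_by_refl.
by apply: nearW => n; rewrite ler_wpM2r ?powR_ge0// lerN2 ltW.
Qed.

(** A parameter above all the [D_cover f (K i) s U] kills every
    [outer_m f (K i) s U], hence their sum, hence [outer_m] of the union. *)
Lemma D_cover_bigcup (K : nat -> set X) s U :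
  D_cover f (\bigcup_i K i) s U
    <= ereal_sup [set D_cover f (K i) s U | i in [set: nat]].
Proof.
apply: le_ereal_real_gt => a supa; apply: ereal_inf_lbound; exists a => //=.
apply/eqP; rewrite eq_le outer_m_ge0 andbT.
apply: le_trans (outer_m_bigcup _ _ _ _) _.
rewrite eseries0// => i _ _; apply: outer_m_eq0.
by apply: le_lt_trans supa; apply: ereal_sup_ubound; exists i.
Qed.

Lemma D_order_bigcup (K : nat -> set X) s :
  D_order f (\bigcup_i K i) s
    = ereal_sup [set D_order f (K i) s | i in [set: nat]].
Proof.
apply/eqP; rewrite eq_le; apply/andP; split; apply: ge_ereal_sup.
  move=> _ [U Ucov <-]; apply: le_trans (D_cover_bigcup K s U) _.
  apply: ge_ereal_sup => _ [i _ <-].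
  apply: le_ereal_sup_tmp; exists (D_order f (K i) s); first by exists i.
  by apply: ereal_sup_ubound; exists U.
by move=> _ [i _ <-]; apply: le_D_order; exact: bigcup_sup.
Qed.

(** * The critical order *)

Lemma powR_dominates (t s a b : R) : (t < s)%R -> (0 < a)%R ->
  \forall n \near \oo, (b * n%:R `^ t <= a * n%:R `^ s)%R.
Proof.
move=> ts a0; have st0 : (0 < s - t)%R by rewrite subr_gt0.
near=> n.
have n0 : (0 < n%:R :> R)%R.
  by rewrite ltr0n; near: n; exact: nbhs_infty_gt.
have -> : (n%:R `^ s = n%:R `^ (s - t) * n%:R `^ t :> R)%R.
  by rewrite -powRD ?subrK// (gt_eqF n0) implybT.
rewrite mulrA ler_wpM2r ?powR_ge0// -ler_pdivrMl//.
(* The threshold is the (s - t)-th root of |b| / a, so that n ^ (s - t)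
   exceeds |b| / a beyond it. *)
have le_root : ((`|a^-1 * b|) `^ (s - t)^-1 <= n%:R)%R.
  by near: n; exact: nbhs_infty_ger.
apply: le_trans (ler_norm _) _.
have -> : (`|a^-1 * b| = (`|a^-1 * b| `^ (s - t)^-1) `^ (s - t))%R.
  by rewrite -powRrM mulVf ?gt_eqF// powRr1.
by apply: ge0_ler_powR => //; rewrite ?nnegrE ?powR_ge0 ?ltW.
Unshelve. all: by end_near. Qed.

(** The jump at the critical order: if [outer_m] is nonzero at order [s] for
    some [a > 0], then since [b * n ^ t] is eventually at most [a * n ^ s] it is
    nonzero at order [t] for every real [b], and [D_cover] is the infimum of the
    empty set. *)
Lemma D_order_eqy K t s :
  (t < s)%R -> 0 < D_order f K s -> D_order f K t = +oo.
Proof.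
move=> ts /ereal_sup_gt[_ [U Ucov <-] D0].
have [a [a0 ma]] : exists a : R, (0 < a)%R /\ outer_m f K s U a != 0.
  apply: contrapT => nex; move: D0; apply/negP; rewrite -leNgt.
  apply/lee_addgt0Pr => e e0; rewrite add0e.
  apply: ereal_inf_lbound; exists e => //=; apply/eqP/negPn/negP => me.
  by apply: nex; exists e.
suff Dy : D_cover f K t U = +oo.
  by apply/eqP; rewrite -leye_eq -Dy; apply: ereal_sup_ubound; exists U.
rewrite /D_cover (_ : [set _ | _ in _] = set0) ?ereal_inf0//.
rewrite -subset0 => _ [b /= mb _]; move/negP: ma; apply.
rewrite eq_le outer_m_ge0 -mb andbT.
apply: le_outer_m => //; first exact: refined_by_refl.
near=> n; rewrite !mulNr lerN2; near: n; exact: powR_dominates.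
Unshelve. all: by end_near. Qed.

(** If the order-[s] dimension of the union is infinite, those of the pieces
    may all be finite with an infinite supremum.  But one of them is positive,
    and by [D_order_eqy] that single piece has infinite dimension at every
    order below [s]. *)
Lemma D_dim_bigcup (K : nat -> set X) :
  D_dim R f (\bigcup_i K i)
    = ereal_sup [set D_dim R f (K i) | i in [set: nat]].
Proof.
apply/eqP; rewrite eq_le; apply/andP; split; last first.
  by apply: ge_ereal_sup => _ [i _ <-]; apply: le_D_dim; exact: bigcup_sup.
have sup0 : 0 <= ereal_sup [set D_dim R f (K i) | i in [set: nat]].
  apply: le_ereal_sup_tmp; exists (D_dim R f (K 0%N)); first by exists 0%N.
  by rewrite le_max lexx.
rewrite /D_dim ge_max sup0/=; apply: ge_ereal_sup => _ [s [s0 Ks] <-].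
have [i Di] : exists i, 0 < D_order f (K i) s.
  have : 0 < ereal_sup [set D_order f (K i) s | i in [set: nat]].
    by rewrite -D_order_bigcup Ks.
  by move=> /ereal_sup_gt[_ [i _ <-] ?]; exists i.
apply: le_ereal_sup_tmp; exists (D_dim R f (K i)); first by exists i.
apply/lee_addgt0Pr => e e0; rewrite -leeBlDr// -EFinB.
have [se|se] := leP (s - e)%R 0%R.
  (* D_dim is nonnegative, and s - e is not an order in this case. *)
  by rewrite le_max lee_fin se.
rewrite le_max; apply/orP; right; apply: ereal_sup_ubound.
exists (s - e)%R; last by [].
by split; [exact: se|apply: D_order_eqy Di; rewrite gtrBl].
Qed.

Lemma join_covers_refines n (U : 'I_n -> set (set X)) i :
  refined_by (U i) (join_covers U).
Proof.
by move=> _ [W UW <-]; exists (W i); [exact: UW|exact: bigcap_inf].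
Qed.

End entropy_properties.

Theorem proposition3p13 (R : realType) (X : topologicalType)
  (f : nat -> X -> X) (alpha s : R) :
  compact [set: X] ->
  (forall i, continuous (f i)) ->
  (0 < s)%R ->
  [/\ forall (K : set X) (U V : set (set X)),
        K !=set0 -> finite_open_cover U -> finite_open_cover V ->
        refined_by U V ->
        outer_m f K s U alpha <= outer_m f K s V alpha /\
        D_cover f K s U <= D_cover f K s V,
      forall (K : set X) (n : nat) (U : 'I_n -> set (set X)),
        K !=set0 -> (0 < n)%N -> (forall i, finite_open_cover (U i)) ->
        \big[maxe/-oo]_(i < n) D_cover f K s (U i)
          <= D_cover f K s (join_covers U),
      forall K Z : set X,
        K !=set0 -> K `<=` Z ->
        D_order f K s <= D_order f Z s /\ D_dim R f K <= D_dim R f Z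
    & forall K : nat -> set X,
        (forall i, K i !=set0) ->
        [/\ forall U : set (set X), finite_open_cover U ->
              outer_m f (\bigcup_i K i) s U alpha
                <= \sum_(0 <= i <oo) outer_m f (K i) s U alpha,
            D_order f (\bigcup_i K i) s
              = ereal_sup [set D_order f (K i) s | i in [set: nat]]
          & D_dim R f (\bigcup_i K i)
              = ereal_sup [set D_dim R f (K i) | i in [set: nat]]]].
Proof.
move=> _ _ _; split.
- move=> K U V _ _ _ UV; split; last exact: le_D_cover.
  by apply: le_outer_m => //; exact: nearW.
- move=> K n U _ _ _; apply: bigmax_le; first exact: leNye.
  by move=> i _; apply: le_D_cover => //; exact: join_covers_refines.
- by move=> K Z _ KZ; split; [exact: le_D_order|exact: le_D_dim].
- move=> K _; split; [|exact: D_order_bigcup|exact: D_dim_bigcup].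
  by move=> U _; exact: outer_m_bigcup.
Qed.
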